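(* Let $S\in\mathcal{P}(\mathcal{L})$. Under the MNL model (choice function $f=\rho$), as $\lambda\to\infty$, $$V^*_{T(\lambda)}(S)-v_{T(\lambda)}(S)=O\left(\frac{\ln^{|S|}(\lambda)}{\lambda}\right),\qquad v_{T(\lambda)}(S):=\frac{-1}{\beta_p}\Big(|S|(\ln\lambda-1)+\kappa(S)\Big).$$ In addition, for all $i\in S$ and $\omega\in\Omega$, the optimal price and choice probability of option $i$ for type $\omega$ at period $T(\lambda)$ (with all options of $S$ available) satisfy, as $\lambda\to\infty$, $$p^{*,\omega}_{T(\lambda),i}=\frac{-1}{\beta_p}\left(\ln(\lambda)+\kappa_i\right)+O\left(\frac{\ln^{|S|}(\lambda)}{\lambda}\right),\qquad \rho^{*,\omega}_{T(\lambda),i}=\frac1\lambda e^{q_i^\omega-\kappa_i}+O\left(\frac{\ln^{|S|}(\lambda)}{\lambda^2}\right).$$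
   Context: Items and options: $\mathcal{L}=\{1,\dots,L\}$ is a finite set of unique items; item $j$ has salvage value $\xi_j\in\mathbb{R}$. An option is a sequence of distinct items (a single item, or a bundle of two or more items); the salvage value $\xi_i$ of an option $i$ is the sum of the salvage values of its items. $\mathcal{O}$ is the set of all options with at most $K_b$ items, and $\mathcal{P}(\mathcal{L})$ is the collection of all sets $S\subseteq\mathcal{O}$ such that each item belongs to exactly one option of $S$ and $S$ contains at most $K_s$ bundles ($K_b,K_s$ given integers). Customers: $\Omega$ is a finite set of customer types; $X$ is a random type with probability mass function $p_X$ on $\Omega$, and $\mathbb{E}_X$ is expectation over $X$. In each period a customer arrives with probability $\mu\in(0,1]$ (fixed), with type distributed as $X$ independently across periods. For demand $\lambda\ge 0$ the number of periods is $T(\lambda)=\lfloor\lambda/\mu\rfloor$; periods are indexed by remaining time $t$, so $t=0$ is the end of the season. Option $i$ has perceived quality $q_i^\omega\in\mathbb{R}$ for type $\omega$ (no relation is assumed between the quality of a bundle and that of its items). The price sensitivity is $\beta_p<0$. MNL model: for a set $S$ of options and price vector $p\in\mathbb{R}^{|S|}$, $\rho_i^\omega(p,S)=\dfrac{e^{q_i^\omega+\beta_p p_i}}{1+\sum_{j\in S}e^{q_j^\omega+\beta_p p_j}}$ for $i\in S$. Value function: for every set $S'$ contained in some member of $\mathcal{P}(\mathcal{L})$, $V_0^*(S')=\sum_{i\in S'}\xi_i$ and, for $t\ge1$, $V_t^*(S')=V_{t-1}^*(S')+\mu\,\mathbb{E}_X\big[R(\rho^X,S',\Delta V_t^*(S'))\big]$,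 where $\Delta_iV_t^*(S')=V^*_{t-1}(S')-V^*_{t-1}(S'\setminus\{i\})$ for $i\in S'$ and $R(g,S',\Delta)=\max_{p\in\mathbb{R}^{|S'|}}\sum_{i\in S'}g_i(p,S')(p_i-\Delta_i)$. The optimal price vector $p_t^{*,\omega}$ (in state $S$) is the maximizer in $R(\rho^\omega,S,\Delta V_t^*(S))$, and $\rho^{*,\omega}_{t,i}=\rho^\omega_i(p_t^{*,\omega},S)$. Aggregated quality: $\kappa_i=\ln\mathbb{E}_X[e^{q_i^X}]$ and $\kappa(S)=\sum_{i\in S}\kappa_i$. *)

(* Defs.v *)
From mathcomp Require Import all_boot all_order all_algebra.
From mathcomp Require Import all_classical all_reals all_analysis.

Set Implicit Arguments.
Unset Strict Implicit.
Unset Printing Implicit Defensive.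

Import Order.TTheory GRing.Theory Num.Theory.
Import numFieldNormedType.Exports.

Local Open Scope ring_scope.

(* Lets +oo be used as the filter of the Landau notations. *)
Canonical pinfty_filter_on (R : realType) :=
  FilterType (pinfty_nbhs R) (@proper_pinfty_nbhs R).

Section Options.

(* The items 1, ..., L are represented by the ordinals 0, ..., L - 1. *)
Definition item_option (L Kb : nat) : finType :=
  {s : Kb.-bseq 'I_L | (0 < size s)%N && uniq s}.

Variables (R : realType) (L Kb : nat).

Definition items (o : item_option L Kb) : seq 'I_L := val o.

Definition is_bundle (o : item_option L Kb) : bool := (1 < size (items o))%N.

Definition option_salvage (xi : 'I_L -> R) (o : item_option L Kb) : R :=
  \sum_(j <- items o) xi j.

Definition feasible_sets (Ks : nat) : {set {set item_option L Kb}} :=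
  finset (fun S : {set item_option L Kb} =>
    [forall j : 'I_L, #|[pred o in S | j \in items o]| == 1%N] &&
    (#|[pred o in S | is_bundle o]| <= Ks)%N).

End Options.

Section Customers.

Variables (R : realType) (Omega : finType).

Definition is_pmf (pX : Omega -> R) : Prop :=
  (forall w, 0 <= pX w) /\ \sum_w pX w = 1.

Definition expect (pX f : Omega -> R) : R := \sum_w pX w * f w.

End Customers.

Section Pricing.

Variables (R : realType) (O : finType).

Definition vec (S : {set O}) : Type := {i | i \in S} -> R.

Definition choice_function : Type := forall S : {set O}, vec S -> vec S.

Definition mnl (beta_p : R) (q : O -> R) : choice_function := fun S p i =>
  expR (q (val i) + beta_p * p i) /
    (1 + \sum_(j : {j | j \in S}) expR (q (val j) + beta_p * p j)).

Definition revenue (g : choice_function) (S : {set O}) (Delta p : vec S) : R :=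
  \sum_(i : {i | i \in S}) g S p i * (p i - Delta i).

(* For the MNL choice function with negative price sensitivity this supremum
   is finite and attained. *)
Definition max_revenue (g : choice_function) (S : {set O}) (Delta : vec S) : R :=
  sup (range (revenue g Delta)).

Definition is_maximizer (g : choice_function) (S : {set O}) (Delta p : vec S) :
    Prop :=
  forall p' : vec S, revenue g Delta p' <= revenue g Delta p.

(* Some maximizer, and the zero vector if there is none. For the MNL choice
   function with negative price sensitivity there is exactly one. *)
Definition maximizer (g : choice_function) (S : {set O}) (Delta : vec S) :
    vec S :=
  xget (fun=> 0) (is_maximizer g Delta : set ({i | i \in S} -> R)).

Definition marginal (V : {set O} -> R) (S : {set O}) : vec S :=
  fun i => V S - V (S :\ val i).

Variables (Omega : finType) (pX : Omega -> R) (mu : R) (xi : O -> R).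
Variable f : Omega -> choice_function.

(* Remaining time t counts down to 0, the end of the season. *)
Fixpoint value (t : nat) (S : {set O}) : R :=
  if t is t'.+1 then
    value t' S +
      mu * expect pX (fun w => max_revenue (f w) (marginal (value t') (S := S)))
  else \sum_(i in S) xi i.

(* The marginal values at remaining time t are computed from the value function
   at t - 1; only t >= 1 is meaningful here. *)
Definition optimal_price (t : nat) (S : {set O}) (w : Omega) : vec S :=
  maximizer (f w) (marginal (value t.-1) (S := S)).

Definition optimal_choice (t : nat) (S : {set O}) (w : Omega) : vec S :=
  f w (optimal_price t w).

End Pricing.

Section Asymptotics.

Variables (R : realType) (O Omega : finType) (pX : Omega -> R).

Definition periods (mu lambda : R) : nat := Num.truncn (lambda / mu).

Definition kappa (q : O -> Omega -> R) (i : O) : R :=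
  ln (expect pX (fun w => expR (q i w))).

Definition kappa_set (q : O -> Omega -> R) (S : {set O}) : R :=
  \sum_(i in S) kappa q i.

Definition approx_value (beta_p : R) (q : O -> Omega -> R) (S : {set O})
    (lambda : R) : R :=
  - 1 / beta_p * (#|S|%:R * (ln lambda - 1) + kappa_set q S).

End Asymptotics.

(* Main.v *)
(* Write b = -beta_p and let W be the inverse of r |-> r e^r. By 1 + z <= e^z,
   with equality only at z = 0, the maximal revenue is W(A) / b with
   A = \sum_i exp (q_i - b Delta_i - 1), and Delta_i + (1 + W(A)) / b is the only
   optimal price vector. Hence X_t(S) = exp (b V_t(S)) satisfies
   X_{t+1} = X_t exp (mu E[W(G_t / X_t)]), where G_t is a combination of the
   X_t(S \ i). By induction on n = |S| and A / (1 + A) <= W(A) <= A,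
     X_{t+1} - X_t = n M t^(n-1) + O(t^(n-2) ln^(n-1) t),
   and summing gives X_t = M t^n + O(t^(n-1) ln^n t). Taking logarithms yields
   the value function, whose differences determine prices and choices. *)

Require Import Defs.
From mathcomp Require Import all_boot all_order all_algebra.
From mathcomp Require Import all_classical all_reals all_analysis.
From mathcomp Require Import ring lra.

Set Implicit Arguments.
Unset Strict Implicit.
Unset Printing Implicit Defensive.

Import Order.TTheory GRing.Theory Num.Theory.
Import numFieldNormedType.Exports.

Local Open Scope ring_scope.

(** * The Lambert W function on the nonnegative reals *)

Section LambertW.

Variable R : realType.
Implicit Types A r : R.

(** For [A >= 0] this is the principal branch of the Lambert function; the default 0 is returned
    only for negative [A]. *)
Definition lambertW A : R := xget 0 [set r : R | 0 <= r /\ r * expR r = A].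

(** Intermediate value theorem on [[0, A]]: [r e^r] vanishes at 0 and is at least [A] at [A]. *)
Lemma lambertWP A : 0 <= A ->
  0 <= lambertW A /\ lambertW A * expR (lambertW A) = A.
Proof.
move=> A0; apply: (@xgetPex _ 0 [set r : R | 0 <= r /\ r * expR r = A]).
have [r rA rE] : exists2 r, r \in `[0, A] & r * expR r = A.
  apply: (@IVT R (fun r => r * expR r)) => //.
    apply: continuous_subspaceT => x.
    by apply: cvgM; [exact: cvg_id | exact: continuous_expR].
  rewrite mul0r min_l ?max_r ?A0 /=; try by rewrite mulr_ge0 // expR_ge0.
  by rewrite ler_peMr // -expR0 ler_expR.
by exists r; split=> //; move: rA; rewrite in_itv /= => /andP[].
Qed.

Lemma lambertW_ge0 A : 0 <= A -> 0 <= lambertW A.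
Proof. by case/lambertWP. Qed.

Lemma lambertW_mulexp A : 0 <= A -> lambertW A * expR (lambertW A) = A.
Proof. by case/lambertWP. Qed.

Lemma lambertW_mulexpN A : 0 <= A -> A * expR (- lambertW A) = lambertW A.
Proof.
move=> /lambertW_mulexp WE.
by rewrite -{1}WE -mulrA -expRD subrr expR0 mulr1.
Qed.

Lemma lambertW_le A : 0 <= A -> lambertW A <= A.
Proof.
move=> A0; have [W0 WE] := lambertWP A0.
by rewrite -{2}WE ler_peMr // -expR0 ler_expR.
Qed.

(** Solve [W = A e^(-W) >= A (1 - W)] for [W]. *)
Lemma lambertW_ge A : 0 <= A -> A / (1 + A) <= lambertW A.
Proof.
move=> A0; rewrite ler_pdivrMr; last by lra.
have := expR_ge1Dx (- lambertW A); have := lambertW_mulexpN A0.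
nra.
Qed.

End LambertW.

(** * Optimal MNL prices for given marginal values *)

Section OptimalPricing.

Variables (R : realType) (O : finType) (beta : R) (q : O -> R) (S : {set O}).
Variable D : vec R S.
Hypothesis beta_lt0 : beta < 0.

Definition attraction : R :=
  \sum_(i : {i | i \in S}) expR (q (val i) + beta * D i - 1).

Lemma attraction_ge0 : 0 <= attraction.
Proof. by apply: sumr_ge0 => i _; exact: expR_ge0. Qed.

Let r := lambertW attraction.

(** The first-order conditions of MNL revenue give every option the same markup over its marginal
    value. *)
Definition markup_price : vec R S := fun i => D i - (1 + r) / beta.

Let e (p : vec R S) i := expR (q (val i) + beta * p i).

(** After division by [e p i] this is [1 + z < e^z] with [z = y - r - 1], which is nonzero exactly
    when the price differs from the markup price. *)
Let e_surplus_lt p i : p i != markup_price i ->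
  e p i * (- beta * (p i - D i) - r)
    < expR (q (val i) + beta * D i - 1) * expR (- r).
Proof.
move=> pi; set y := - beta * (p i - D i).
have -> : e p i = expR (q (val i) + beta * D i - 1) * expR (- r)
                  / expR (y - r - 1).
  by rewrite /e -expRD -expRB; congr expR; rewrite /y; ring.
rewrite mulrAC ltr_pdivrMr ?expR_gt0 // ltr_pM2l; last first.
  by rewrite mulr_gt0 // expR_gt0.
rewrite -{1}[y - r](addrNK 1) addrC; apply: expR_gt1Dx; apply: contra pi => /eqP yE.
apply/eqP; have {}yE : - beta * (p i - D i) = 1 + r.
  by apply/eqP; rewrite -subr_eq0 -/y opprD addrA addrAC yE.
by rewrite /markup_price -yE; field; rewrite lt_eqF.
Qed.

Let e_surplus_markup i :
  e markup_price i * (- beta * (markup_price i - D i) - r)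
    = expR (q (val i) + beta * D i - 1) * expR (- r).
Proof.
have b0 : beta != 0 by rewrite lt_eqF.
have -> : - beta * (markup_price i - D i) - r = 1.
  by rewrite /markup_price; field.
by rewrite mulr1 /e -expRD; congr expR; rewrite /markup_price; field.
Qed.

(** The denominator is positive, so the sign of the revenue gap is that of a numerator whose sum can
    be bounded term by term. *)
Let revenueE p :
  revenue (mnl beta q) D p - r / - beta =
  (\sum_i e p i * (- beta * (p i - D i) - r) - r)
    / (- beta * (1 + \sum_i e p i)).
Proof.
have b0 : beta != 0 by rewrite lt_eqF.
have e0 : 1 + \sum_i e p i != 0.
  by rewrite lt0r_neq0 // ltr_wpDr // sumr_ge0 // => i _; exact: expR_ge0.
have -> : \sum_i e p i * (- beta * (p i - D i) - r) =
   - beta * \sum_i e p i * (p i - D i) - r * \sum_i e p i.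
  by rewrite !mulr_sumr -sumrB; apply: eq_bigr => i _; ring.
have -> : revenue (mnl beta q) D p =
    (\sum_i e p i * (p i - D i)) / (1 + \sum_i e p i).
  by rewrite /revenue mulr_suml; apply: eq_bigr => i _; rewrite /mnl mulrAC.
by field; apply/andP.
Qed.

Let den_gt0 p : 0 < - beta * (1 + \sum_i e p i).
Proof.
rewrite mulr_gt0 ?oppr_gt0 // ltr_wpDr // sumr_ge0 // => i _; exact: expR_ge0.
Qed.

Let sum_attraction : \sum_(i : {i | i \in S})
  expR (q (val i) + beta * D i - 1) * expR (- r) = r.
Proof. by rewrite -mulr_suml lambertW_mulexpN // attraction_ge0. Qed.

Lemma revenue_markup_price : revenue (mnl beta q) D markup_price = r / - beta.
Proof.
apply/eqP; rewrite -subr_eq0 revenueE (eq_bigr _ (fun i _ => e_surplus_markup i)).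
by rewrite sum_attraction subrr mul0r.
Qed.

(** One coordinate that differs makes its term strictly smaller; the other terms are at most their
    values at the markup price, which sum to [r]. *)
Lemma revenue_lt p : p != markup_price ->
  revenue (mnl beta q) D p < revenue (mnl beta q) D markup_price.
Proof.
move=> pm; have [i pi] : exists i, p i != markup_price i.
  apply: contrapT => H; move/eqP: pm; apply; apply/funext => i.
  by apply/eqP/negPn/negP => ?; apply: H; exists i.
rewrite revenue_markup_price -subr_lt0 revenueE ltr_pdivrMr // mul0r subr_lt0.
rewrite -[ltRHS]sum_attraction (bigD1 i) //= [ltRHS](bigD1 i) //=.
rewrite ltr_leD ?e_surplus_lt //; apply: ler_sum => j _.
have [pj|/e_surplus_lt/ltW//] := eqVneq (p j) (markup_price j).
by rewrite -(e_surplus_markup j) /e pj.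
Qed.

Lemma revenue_le p :
  revenue (mnl beta q) D p <= revenue (mnl beta q) D markup_price.
Proof. by have [->//|/revenue_lt/ltW] := eqVneq p markup_price. Qed.

Lemma max_revenueE : max_revenue (mnl beta q) D = r / - beta.
Proof.
rewrite -revenue_markup_price; apply/eqP; rewrite eq_le; apply/andP; split.
  apply: ge_sup => [|_ [p _ <-]]; last exact: revenue_le.
  by exists (revenue (mnl beta q) D markup_price), markup_price.
apply: ub_le_sup; last by exists markup_price.
by exists (revenue (mnl beta q) D markup_price) => _ [p _ <-]; exact: revenue_le.
Qed.

(** Strictness in [revenue_lt] leaves a single candidate for the arbitrary choice made by
    [maximizer]. *)
Lemma maximizerE : maximizer (mnl beta q) D = markup_price.
Proof.
have maxP : is_maximizer (mnl beta q) D (maximizer (mnl beta q) D).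
  apply: (@xgetPex _ _ (is_maximizer (mnl beta q) D : set (vec R S))).
  by exists markup_price => p; exact: revenue_le.
have [//|/revenue_lt] := eqVneq (maximizer (mnl beta q) D) markup_price.
by rewrite ltNge maxP.
Qed.

(** At the optimum each factor [- beta * (p i - D i) - r] equals 1, so the attractions [e p i] add
    up to [r]. *)
Lemma mnl_markup_price i :
  mnl beta q markup_price i =
    expR (q (val i) + beta * markup_price i) / (1 + r).
Proof.
have b0 : beta != 0 by rewrite lt_eqF.
rewrite /mnl -[in RHS]sum_attraction; congr (_ / (1 + _)).
apply: eq_bigr => j _; rewrite -e_surplus_markup /e.
by rewrite (_ : - beta * (markup_price j - D j) - r = 1) ?mulr1 // /markup_price; field.
Qed.

End OptimalPricing.

(** * Elementary growth estimates and summation of increments *)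

Section Growth.

Local Open Scope classical_set_scope.
Local Open Scope ring_scope.

Variable R : realType.
Implicit Types (m t : nat) (c x : R).

(** With [y = ln x], one term of the exponential series gives [y^(m+1) <= (m+1)! x]; for
    [y >= (m+1)! / c] a factor [y] can be divided out. *)
Lemma near_ln_pow_le m c : 0 < c -> \forall x \near +oo, ln x ^+ m <= c * x :> R.
Proof.
move=> c0; pose F : R := m.+1`!%:R; near=> x; pose y := ln x.
have F0 : 0 < F by rewrite ltr0n fact_gt0.
have x0 : 0 < x by near: x; apply: nbhs_pinfty_gt; exact: num_real.
have yF : F / c <= y.
  rewrite /y -(expRK (F / c)) ler_ln ?posrE ?expR_gt0 ?x0 //=.
have y0 : 0 < y by rewrite (lt_le_trans _ yF) // divr_gt0.
have xF : y ^+ m * y <= F * x.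
  have := expR_ge1Dxn m (ltW y0); rewrite lnK ?posrE // => H.
  rewrite -exprSr mulrC -ler_pdivrMr //; apply: le_trans H.
  by rewrite lerDr.
have u0 : 0 <= y ^+ m by rewrite exprn_ge0 // ltW.
have := le_trans (ler_wpM2l u0 yF) xF.
by rewrite mulrA ler_pdivrMr // (mulrC _ F) -mulrA ler_pM2l // (mulrC x).
Unshelve. all: by end_near. Qed.

Lemma near_natr (P : R -> Prop) :
  (\forall x \near +oo, P x) -> \forall t \near \oo, P t%:R.
Proof. by move=> PP; exact: (@cvgr_idn R). Qed.

Lemma near_real_ge (y : R) : \forall x \near +oo, y <= x.
Proof. by apply: nbhs_pinfty_ge; exact: num_real. Qed.

Lemma near_nat_ge (y : R) : \forall t \near \oo, y <= t%:R.
Proof. exact: near_natr (near_real_ge y). Qed.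

Lemma near_ln_ge1 : \forall x \near +oo, 1 <= ln x :> R.
Proof.
near=> x; have xe : expR 1 <= x by near: x; exact: near_real_ge.
have x0 := lt_le_trans (expR_gt0 1) xe.
by rewrite -{1}(expRK 1) ler_ln ?posrE ?expR_gt0.
Unshelve. all: by end_near. Qed.

(** The binomial remainder after two terms is [O(t^(m-1))]. Multiplying by [t] avoids a negative
    exponent at [m = 0]; the later error bounds are written in the same way. *)
Lemma exprS_succ_expand m : exists2 K : R, 0 <= K & forall t, (0 < t)%N ->
  0 <= t.+1%:R ^+ m.+1 - t%:R ^+ m.+1 - m.+1%:R * t%:R ^+ m :> R /\
  (t.+1%:R ^+ m.+1 - t%:R ^+ m.+1 - m.+1%:R * t%:R ^+ m) * t%:R <= K * t%:R ^+ m.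
Proof.
elim: m => [|m [K K0 IH]].
  by exists 0 => // t t0; rewrite !expr1 expr0 -(natr1 t); split; lra.
exists (m.+1%:R + 2 * K) => [|t t0]; first by rewrite addr_ge0 // mulr_ge0.
have [] := IH t t0; set r := t.+1%:R ^+ m.+1 - _ - _ => r0 rt.
have t1 : 1 <= t%:R :> R by rewrite ler1n.
(* Multiplying the expansion for [m] by [t + 1] expresses the next remainder through [r]. *)
have -> : t.+1%:R ^+ m.+2 - t%:R ^+ m.+2 - m.+2%:R * t%:R ^+ m.+1 =
  m.+1%:R * t%:R ^+ m + (t%:R + 1) * r.
  have E : t.+1%:R ^+ m.+1 = t%:R ^+ m.+1 + m.+1%:R * t%:R ^+ m + r.
    by rewrite /r; ring.
  by rewrite exprS E -(natr1 t) -(natr1 m.+1) !exprS; ring.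
split; first by rewrite addr_ge0 // mulr_ge0 // ?exprn_ge0 // addr_ge0.
rewrite mulrDl exprS.
have -> : (t%:R + 1) * r * t%:R = (t%:R + 1) * (r * t%:R) by ring.
have : 0 <= K * t%:R ^+ m by rewrite mulr_ge0 // exprn_ge0.
set u := t%:R ^+ m in rt *; nra.
Qed.

(** Summation by comparison: the increments of [t^m ln^(m+1) t] dominate [t^(m-1) ln^m t] up to a
    factor 2. The additional logarithm already appears for [m = 0], where [1 / t] is summed. *)
Lemma sum_log_bound m (Z : nat -> R) (K : R) : 0 <= K ->
  (\forall t \near \oo, `|Z t.+1 - Z t| * t%:R <= K * (t%:R * ln t%:R) ^+ m) ->
  exists2 C, 0 <= C &
    \forall t \near \oo, `|Z t| * t%:R <= C * (t%:R * ln t%:R) ^+ m.+1.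
Proof.
(* Starting at 2 or later makes [ln t], hence the comparison function [W t], positive. *)
move=> K0 [t1 _ HZ]; pose t0 := maxn t1 2; pose W t := t%:R ^+ m * ln t%:R ^+ m.+1 : R.
have W0 t : (t0 <= t)%N -> 0 < W t.
  rewrite geq_max => /andP[_ t2]; rewrite mulr_gt0 ?exprn_gt0 ?ltr0n ?(ltn_trans _ t2)//.
  by rewrite ln_gt0 // ltr1n.
(* The first summand pays for the increments, the second for the initial value [Z t0]. *)
pose C := 2 * K + `|Z t0| / W t0.
have C0 : 0 <= C by apply: addr_ge0; [rewrite mulr_ge0|rewrite divr_ge0 // ltW // W0].
exists C => //; exists t0 => // t /= t0t.
suff ZW : `|Z t| <= C * W t.
  have -> : C * (t%:R * ln t%:R) ^+ m.+1 = C * W t * t%:R.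
    by rewrite /W exprMn exprS; ring.
  exact: ler_wpM2r.
rewrite -(subnK t0t); elim: (t - t0)%N => [|k IH].
  rewrite add0n /C mulrDl divfK ?gt_eqF ?W0 // lerDr.
  by apply: mulr_ge0; [exact: mulr_ge0|exact/ltW/W0].
rewrite addSn; move: (k + t0)%N (leq_addl k t0) IH => {t0t} s st IH.
move: (st); rewrite geq_max => /andP[s1 s2].
have s0 : 0 < s%:R :> R by rewrite ltr0n (ltn_trans _ s2).
have l0 : 0 <= ln s%:R :> R by rewrite ln_ge0 // ler1n (ltn_trans _ s2).
(* This is [ln (1 - 1 / (s + 1)) <= - 1 / (s + 1)] rearranged. *)
have lS : ln s%:R + s.+1%:R^-1 <= ln s.+1%:R :> R.
  have S0 : 0 < s.+1%:R :> R by rewrite ltr0n.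
  have : ln (1 + - s.+1%:R^-1) <= - s.+1%:R^-1 :> R.
    by rewrite le_ln1Dx // ltrN2 invf_lt1 // ltr1n ltnS (ltn_trans _ s2).
  have -> : 1 + - s.+1%:R^-1 = s%:R / s.+1%:R :> R.
    rewrite -[s%:R](addrK 1) natr1; field; by rewrite gt_eqF.
  by rewrite ln_div ?posrE // => H; rewrite addrC -lerBrDr -lerN2 opprB.
(* By [lS], one of the [m + 1] logarithms gains [1 / (s + 1)], which is at least [1 / (2 s)]. *)
have WS : (s%:R * ln s%:R) ^+ m <= 2 * (W s.+1 - W s) * s%:R.
  rewrite exprMn.
  have s1R : 1 <= s%:R :> R by rewrite ler1n -(ltr0n R).
  have sW : s%:R ^+ m * (ln s%:R ^+ m * (ln s%:R + s.+1%:R^-1)) <= W s.+1.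
    apply: ler_pM; rewrite ?exprn_ge0 ?mulr_ge0 ?addr_ge0 ?exprn_ge0 //.
      by rewrite lerXn2r ?nnegrE ?ler_nat.
    have l1 : ln s%:R <= ln s.+1%:R :> R.
      by apply: le_trans lS; rewrite lerDl invr_ge0.
    rewrite exprSr ler_pM ?exprn_ge0 ?addr_ge0 ?invr_ge0 //.
    by rewrite lerXn2r ?nnegrE // (le_trans l0).
  have {}sW : s%:R ^+ m * ln s%:R ^+ m / s.+1%:R <= W s.+1 - W s.
    rewrite lerBrDl; apply: le_trans sW; rewrite /W exprSr.
    by rewrite le_eqVlt; apply/orP; left; apply/eqP; ring.
  have : 1 <= 2 / s.+1%:R * s%:R :> R.
    by rewrite mulrAC ler_pdivlMr ?ltr0n // -(natr1 s); lra.
  have u0 : 0 <= s%:R ^+ m * ln s%:R ^+ m :> R.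
    by rewrite mulr_ge0 ?exprn_ge0.
  move=> /(ler_wpM2l u0); rewrite mulr1 => /le_trans; apply.
  set u := s%:R ^+ m * _ in sW *; set v := s.+1%:R^-1 in sW *.
  have -> : u * (2 * v * s%:R) = 2 * (u * v) * s%:R by ring.
  by apply: ler_wpM2r (ltW s0) _ _ _; apply: ler_wpM2l.
have dW : 0 <= W s.+1 - W s.
  rewrite -(pmulr_lge0 _ s0) -(pmulr_rge0 _ (ltr0n R 2)) mulrA.
  by apply: le_trans WS; rewrite exprn_ge0 // mulr_ge0.
have dZ : `|Z s.+1 - Z s| <= C * (W s.+1 - W s).
  rewrite -(ler_pM2r s0); apply: le_trans (HZ _ s1) _.
  apply: le_trans (ler_wpM2l K0 WS) _.
  have -> : K * (2 * (W s.+1 - W s) * s%:R) = 2 * K * ((W s.+1 - W s) * s%:R).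
    by ring.
  rewrite -[leRHS]mulrA ler_wpM2r ?mulr_ge0 ?(ltW s0) //.
  by rewrite lerDl divr_ge0 // ltW // W0.
rewrite -(subrK (Z s) (Z s.+1)); apply: le_trans (ler_normD _ _) _.
by move: dZ IH; rewrite mulrBr; lra.
Qed.

End Growth.

(** * Polynomial growth of a recursion [X_{t+1} = X_t exp(E_t)] with [E_t] close to [h_t / X_t] *)

Section Recursion.

Local Open Scope classical_set_scope.
Local Open Scope ring_scope.

Variables (R : realType) (m : nat) (X E h : nat -> R) (M D C : R).

Hypotheses (M0 : 0 < M) (D0 : 0 < D) (C0 : 0 <= C).
Hypothesis X0 : forall t, 0 < X t.
Hypothesis XS : forall t, X t.+1 = X t * expR (E t).
Hypothesis E_le : forall t, E t <= h t / X t.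
Hypothesis E_ge : \forall t \near \oo, h t / (X t + D * t%:R ^+ m) <= E t.
Hypothesis h_asymp : \forall t \near \oo,
  `|h t - m.+1%:R * M * t%:R ^+ m| * t%:R <= C * (t%:R * ln t%:R) ^+ m.

Let N : R := m.+1%:R * M.

Let N0 : 0 < N. Proof. by rewrite mulr_gt0. Qed.

Let h_bounds : \forall t \near \oo,
  N / 2 * t%:R ^+ m <= h t /\ h t <= 2 * N * t%:R ^+ m.
Proof.
(* Once [ln^m t <= c t], the error in [h_asymp] is at most [N / 2 * t^m]; [C + 1] keeps the divisor
   positive. *)
pose c := N / 2 / (C + 1).
have C1 : 0 < C + 1 by rewrite ltr_wpDl.
have c0 : 0 < c by rewrite !divr_gt0.
near=> t.
have t1 : 1 <= t%:R :> R by near: t; exact: near_nat_ge.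
have t0 : 0 < t%:R :> R by exact: lt_le_trans t1.
have ht : `|h t - N * t%:R ^+ m| * t%:R <= C * (t%:R * ln t%:R) ^+ m.
  by near: t; exact: h_asymp.
have lt : ln t%:R ^+ m <= c * t%:R.
  by near: t; exact: near_natr (near_ln_pow_le _ c0).
have u0 : 0 <= t%:R ^+ m :> R by rewrite exprn_ge0 // ltW.
have {ht lt} : `|h t - N * t%:R ^+ m| <= N / 2 * t%:R ^+ m.
  rewrite -(ler_pM2r t0); apply: le_trans ht _.
  have -> : N / 2 * t%:R ^+ m * t%:R = (C + 1) * (t%:R ^+ m * (c * t%:R)).
    by rewrite /c; field; rewrite gt_eqF.
  rewrite exprMn; apply: ler_pM => //.
  - by rewrite mulr_ge0 // exprn_ge0 // ln_ge0.
  - by rewrite lerDl.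
  - by rewrite ler_wpM2l.
by rewrite ler_norml => /andP[]; split; lra.
Unshelve. all: by end_near. Qed.

(* The threshold t0 depends only on N, D and m: below D t^m, X grows at least by
   the fixed factor 1 + k, and above it by at least N / 4 * t^m. Only then is c
   chosen so that the bound holds at t0. *)
Let X_ge : exists2 c : R, 0 < c & \forall t \near \oo, c * t%:R ^+ m.+1 <= X t.
Proof.
have [K K0 HK] := exprS_succ_expand R m.
pose k := N / (4 * D); pose Q : R := m.+1%:R + K.
have k0 : 0 < k by rewrite divr_gt0 // mulr_gt0.
have Q0 : 0 < Q by rewrite ltr_wpDr.
have [t0 _ H] : \forall t \near \oo, [/\ 1 <= t%:R :> R, Q / k <= t%:R,
    N / 2 * t%:R ^+ m <= h t & h t / (X t + D * t%:R ^+ m) <= E t].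
  near=> t; split.
  - by near: t; exact: near_nat_ge.
  - by near: t; exact: near_nat_ge.
  - suff [] : N / 2 * t%:R ^+ m <= h t /\ h t <= 2 * N * t%:R ^+ m by [].
    by near: t; exact: h_bounds.
  - by near: t; exact: E_ge.
pose c := Num.min (N / 4 / Q) (X t0 / t0%:R ^+ m.+1).
have t01 : 1 <= t0%:R :> R by have [] := H t0 (leqnn _).
have c0 : 0 < c.
  by rewrite lt_min !divr_gt0 // exprn_gt0 // (lt_le_trans ltr01).
exists c => //; exists t0 => // t /= t0t.
rewrite -(subnK t0t); elim: (t - t0)%N => [|s IH].
  rewrite add0n -ler_pdivlMr; last by rewrite exprn_gt0 // (lt_le_trans ltr01).
  by rewrite ge_min lexx orbT.
rewrite addSn; move: (s + t0)%N (leq_addl s t0) IH => {t0t}{}s st IH.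
have [s1 sQ hs Es] := H s st.
have s0 : 0 < s%:R :> R by exact: lt_le_trans s1.
have u0 : 0 < s%:R ^+ m :> R by rewrite exprn_gt0.
have succ_le : s.+1%:R ^+ m.+1 <= s%:R ^+ m.+1 + Q * s%:R ^+ m.
  have [] := HK s; first by rewrite -(ltr0n R).
  set e := _ - _ - _ => e0 es.
  have : e <= K * s%:R ^+ m by apply: le_trans es; rewrite ler_peMr.
  by rewrite /e /Q mulrDl; lra.
have DX0 : 0 < X s + D * s%:R ^+ m by rewrite addr_gt0 // mulr_gt0.
have {}Es : N / 2 * s%:R ^+ m / (X s + D * s%:R ^+ m) <= E s.
  by apply: le_trans Es; rewrite ler_pM2r // invr_gt0.
have XE : X s * (1 + E s) <= X s.+1.
  by rewrite XS ler_pM2l // expR_ge1Dx.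
apply: le_trans (ler_wpM2l (ltW c0) succ_le) _; apply: le_trans XE.
have [XD|DX] := leP (X s) (D * s%:R ^+ m).
  have kE : k <= E s.
    apply: le_trans Es; rewrite ler_pdivlMr // /k mulrAC ler_pdivrMr ?mulr_gt0 //.
    have : N * X s <= N * (D * s%:R ^+ m) by rewrite ler_wpM2l // ltW.
    by nra.
  (* Beyond [Q / k], the relative growth [k] is at least [Q / s], the bound on the relative growth
     of [s^(m+1)]. *)
  have Qk : Q * s%:R ^+ m <= k * s%:R ^+ m.+1.
    by rewrite exprS mulrA ler_pM2r // mulrC -ler_pdivrMr.
  have : X s * (1 + k) <= X s * (1 + E s) by rewrite ler_pM2l // lerD2l.
  apply: le_trans; apply: le_trans (_ : c * s%:R ^+ m.+1 * (1 + k) <= _).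
    by rewrite -mulrA ler_pM2l // mulrDr mulr1 lerD2l [leRHS]mulrC.
  by rewrite ler_wpM2r // addr_ge0 // ltW.
have XE : N / 4 * s%:R ^+ m <= X s * E s.
  have : X s * (N / 2 * s%:R ^+ m / (X s + D * s%:R ^+ m)) <= X s * E s.
    by rewrite ler_pM2l.
  apply: le_trans; rewrite mulrA ler_pdivlMr //.
  have : 0 <= N * s%:R ^+ m * (X s - D * s%:R ^+ m).
    by rewrite mulr_ge0 ?mulr_ge0 ?subr_ge0 // ltW.
  by lra.
rewrite [leRHS]mulrDr mulr1 mulrDr; apply: lerD => //; apply: le_trans XE.
by rewrite mulrA ler_pM2r // -ler_pdivlMr // ge_min lexx.
Unshelve. all: by end_near. Qed.

(** By [X_ge], [E = O(1 / t)]. Hence the quadratic part of [X (e^E - 1)] and the loss from replacing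
    [h / X] by [h / (X + D t^m)] are both [O(t^(m-1))], so the increment equals [h] up to that
    order. *)
Let X_increment : exists2 K : R, 0 <= K & \forall t \near \oo,
  `|X t.+1 - X t - N * t%:R ^+ m| * t%:R <= K * (t%:R * ln t%:R) ^+ m.
Proof.
have [c c0 X_ge_c] := X_ge.
(* [a] bounds [t h / X], from [h <= 2 N t^m] and [X >= c t^(m+1)]. *)
pose a := 2 * N / c; have a0 : 0 < a by rewrite divr_gt0 // mulr_gt0.
pose K1 := 4 * N * a; pose K2 := D * a.
have K10 : 0 < K1 by rewrite mulr_gt0 // mulr_gt0.
have K20 : 0 < K2 by rewrite mulr_gt0.
exists (C + (K1 + K2)); first by rewrite addr_ge0 // ltW // addr_gt0.
near=> t.
have t1 : 1 <= t%:R :> R by near: t; exact: near_nat_ge.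
have t0 : 0 < t%:R :> R by exact: lt_le_trans t1.
have ln1 : 1 <= ln t%:R :> R by near: t; exact: near_natr (near_ln_ge1 R).
have t2a : 2 * a <= t%:R by near: t; exact: near_nat_ge.
have Xc : c * t%:R ^+ m.+1 <= X t by near: t.
have ht : `|h t - N * t%:R ^+ m| * t%:R <= C * (t%:R * ln t%:R) ^+ m.
  by near: t; exact: h_asymp.
have hb : N / 2 * t%:R ^+ m <= h t /\ h t <= 2 * N * t%:R ^+ m.
  by near: t; exact: h_bounds.
have Eg : h t / (X t + D * t%:R ^+ m) <= E t by near: t; exact: E_ge.
have Xt := X0 t; have El := E_le t.
have u0 : 0 < t%:R ^+ m :> R by rewrite exprn_gt0.
have uln : t%:R ^+ m <= (t%:R * ln t%:R) ^+ m :> R.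
  by rewrite lerXn2r ?nnegrE ?mulr_ge0 ?ler_peMr // ltW // (lt_le_trans ltr01).
have h0 : 0 < h t by apply: lt_le_trans hb.1; rewrite !mulr_gt0.
have DX0 : 0 < X t + D * t%:R ^+ m by rewrite addr_gt0 // mulr_gt0.
have E0 : 0 <= E t by apply: le_trans Eg; rewrite divr_ge0 // ltW.
have hX : h t / X t * t%:R <= a.
  rewrite mulrAC ler_pdivrMr // /a mulrAC ler_pdivlMr //.
  have : h t * (c * t%:R) <= 2 * N * t%:R ^+ m * (c * t%:R).
    by rewrite ler_pM2r ?hb.2 // mulr_gt0.
  have : 2 * N * (c * t%:R ^+ m.+1) <= 2 * N * X t by rewrite ler_pM2l // mulr_gt0.
  by rewrite exprS; lra.
have Ea : E t * t%:R <= a by apply: le_trans hX; rewrite ler_pM2r.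
have E2 : E t <= 1 / 2 by rewrite -(ler_pM2r t0); lra.
have XE : X t * E t <= h t by rewrite mulrC -ler_pdivlMr.
(* For [E <= 1/2] both sides are compared after multiplication by [1 - E]: [e^E (1 - E) <= 1],
   whereas the polynomial gives [1 + E^2 (1 - 2 E) >= 1]. *)
have exp_le : expR (E t) <= 1 + E t + 2 * E t ^+ 2.
  have : expR (E t) * (1 - E t) <= 1.
    rewrite -[leRHS](expRxMexpNx_1 (E t)) ler_pM2l ?expR_gt0 //.
    exact: expR_ge1Dx.
  have : 1 <= (1 + E t + 2 * E t ^+ 2) * (1 - E t).
    rewrite -subr_ge0 (_ : _ - _ = E t ^+ 2 * (1 - 2 * E t)); last by ring.
    by rewrite mulr_ge0 ?exprn_ge0 // subr_ge0; lra.
  have E1 : 0 < 1 - E t by lra.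
  by move=> H1 H2; rewrite -(ler_pM2r E1); exact: le_trans H1.
have upper : (X t.+1 - X t - h t) * t%:R <= K1 * t%:R ^+ m.
  have : X t * expR (E t) <= X t * (1 + E t + 2 * E t ^+ 2) by rewrite ler_pM2l.
  have : 2 * (X t * E t) * (E t * t%:R) <= 2 * h t * a.
    by rewrite ler_pM ?mulr_ge0 ?ler_pM2l // ltW.
  have : 2 * h t * a <= 2 * (2 * N * t%:R ^+ m) * a.
    by rewrite ler_pM2r // ler_pM2l // hb.2.
  rewrite XS /K1; set u := t%:R ^+ m; set e := expR _.
  move=> H1 H2 H3; have : (X t * e - X t - h t) * t%:R <=
     2 * (X t * E t) * E t * t%:R by rewrite ler_pM2r //; lra.
  by lra.
have lower : - (K2 * t%:R ^+ m) <= (X t.+1 - X t - h t) * t%:R.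
  have XE1 : X t * (1 + E t) <= X t.+1 by rewrite XS ler_pM2l // expR_ge1Dx.
  have XEh : h t - D * t%:R ^+ m * (h t / X t) <= X t * E t.
    have : X t * (h t / (X t + D * t%:R ^+ m)) <= X t * E t by rewrite ler_pM2l.
    apply: le_trans; rewrite [leRHS]mulrA ler_pdivlMr //.
    rewrite -subr_ge0 (_ : _ - _ =
      (D * t%:R ^+ m) ^+ 2 * (h t / X t)); last by field; rewrite gt_eqF.
    by rewrite mulr_ge0 ?exprn_ge0 ?divr_ge0 // ltW // mulr_gt0.
  have : D * t%:R ^+ m * (h t / X t * t%:R) <= D * t%:R ^+ m * a.
    by rewrite ler_pM2l // mulr_gt0.
  have : (- (D * t%:R ^+ m * (h t / X t))) * t%:R <= (X t.+1 - X t - h t) * t%:R.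
    by rewrite ler_pM2r //; lra.
  by rewrite /K2; lra.
rewrite (_ : X t.+1 - X t - _ =
  (h t - N * t%:R ^+ m) + (X t.+1 - X t - h t)); last by ring.
apply: le_trans (ler_wpM2r (ltW t0) (ler_normD _ _)) _.
rewrite mulrDl [leRHS]mulrDl lerD //; apply: le_trans (_ : (K1 + K2) * t%:R ^+ m <= _).
  rewrite -{1}(ger0_norm (ltW t0)) -normrM ler_norml mulrDl; apply/andP.
  have : 0 < K1 * t%:R ^+ m by rewrite mulr_gt0.
  have : 0 < K2 * t%:R ^+ m by rewrite mulr_gt0.
  by split; lra.
by rewrite ler_pM2l // addr_gt0.
Unshelve. all: by end_near. Qed.

(** The increments of [X_t - M t^(m+1)] consist of the error in [X_increment] and the binomial
    remainder; [sum_log_bound] adds them up. *)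
Lemma recursion_asymptotics : exists2 K : R, 0 <= K & \forall t \near \oo,
  `|X t - M * t%:R ^+ m.+1| * t%:R <= K * (t%:R * ln t%:R) ^+ m.+1.
Proof.
have [K K0 HK] := X_increment; have [Q Q0 HQ] := exprS_succ_expand R m.
apply: (@sum_log_bound _ m _ (K + M * Q)).
  by rewrite addr_ge0 // mulr_ge0 // ltW.
near=> t.
have t1 : 1 <= t%:R :> R by near: t; exact: near_nat_ge.
have t0 : 0 < t%:R :> R by exact: lt_le_trans t1.
have ln1 : 1 <= ln t%:R :> R by near: t; exact: near_natr (near_ln_ge1 R).
have XK : `|X t.+1 - X t - N * t%:R ^+ m| * t%:R <= K * (t%:R * ln t%:R) ^+ m.
  by near: t.
have [] := HQ t; first by rewrite -(ltr0n R).
set e := _ - _ - _ => e0 et.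
have uln : t%:R ^+ m <= (t%:R * ln t%:R) ^+ m :> R.
  by rewrite lerXn2r ?nnegrE ?mulr_ge0 ?ler_peMr // ltW // (lt_le_trans ltr01).
have -> : X t.+1 - M * t.+1%:R ^+ m.+1 - (X t - M * t%:R ^+ m.+1) =
  (X t.+1 - X t - N * t%:R ^+ m) - M * e by rewrite /e /N; ring.
apply: le_trans (ler_wpM2r (ltW t0) (ler_normB _ _)) _.
rewrite mulrDl [leRHS]mulrDl lerD // normrM (gtr0_norm M0) (ger0_norm e0).
rewrite -!mulrA ler_pM2l //; apply: le_trans et _.
exact: ler_wpM2l.
Unshelve. all: by end_near. Qed.

End Recursion.

(** * Asymptotics of the exponentiated value function *)

Section ValueAsymptotics.

Local Open Scope classical_set_scope.
Local Open Scope ring_scope.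

Variables (R : realType) (O Omega : finType) (pX : Omega -> R) (mu beta : R).
Variables (xi : O -> R) (q : O -> Omega -> R).
Hypotheses (pXP : is_pmf pX) (mu0 : 0 < mu) (beta_lt0 : beta < 0).

Let V := value pX mu xi (fun w => mnl beta (fun i => q i w)).

Definition exp_value t (S : {set O}) : R := expR (- beta * V t S).

Let A t (S : {set O}) w : R :=
  attraction beta (fun i => q i w) (marginal (V t) (S := S)).

Let G t (S : {set O}) w : R :=
  \sum_(i in S) expR (q i w - 1) * exp_value t (S :\ i).

Let E t S : R := mu * expect pX (fun w => lambertW (A t S w)).

Let h t S : R := mu * expect pX (G t S).

Let exp_value_gt0 t S : 0 < exp_value t S. Proof. exact: expR_gt0. Qed.

Let G_ge0 t S w : 0 <= G t S w.
Proof. by apply: sumr_ge0 => i _; rewrite mulr_ge0 // ltW // expR_gt0. Qed.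

(** A marginal value is a difference of values, so its exponential is the ratio of the exponentiated
    values of [S :\ i] and [S]. *)
Let AE t S w : A t S w = G t S w / exp_value t S.
Proof.
rewrite /A /attraction /G mulr_suml [RHS]big_sub; apply: eq_bigr => i _.
by rewrite /exp_value -expRD -expRB; congr expR; rewrite /marginal; ring.
Qed.

Lemma ler_expect (f g : Omega -> R) :
  (forall w, f w <= g w) -> expect pX f <= expect pX g.
Proof. by move=> fg; apply: ler_sum => w _; rewrite ler_wpM2l ?pXP.1. Qed.

Lemma expectZ (f : Omega -> R) c : expect pX (fun w => f w * c) = expect pX f * c.
Proof. by rewrite /expect mulr_suml; apply: eq_bigr => w _; rewrite mulrA. Qed.

(** A zero mean would force every [pX w] to vanish, against total mass 1. This makes the logarithm
    in [kappa] genuine. *)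
Lemma expect_gt0 (f : Omega -> R) : (forall w, 0 < f w) -> 0 < expect pX f.
Proof.
move=> f0; have [p0 p1] := pXP.
have pf w : 0 <= pX w * f w by rewrite mulr_ge0 // ltW.
rewrite lt_neqAle sumr_ge0 // andbT eq_sym; apply/negP.
rewrite psumr_eq0 // => /allP fw; suff : \sum_w pX w = 0 by lra.
apply: big1 => w _; have := fw w (mem_index_enum _).
by rewrite /= mulf_eq0 (gt_eqF (f0 w)) orbF => /eqP.
Qed.

Let exp_valueS t S : exp_value t.+1 S = exp_value t S * expR (E t S).
Proof.
have b0 : beta != 0 by rewrite lt_eqF.
rewrite /exp_value -expRD; congr expR; rewrite /V /= -/V.
rewrite /expect (eq_bigr (fun w => pX w * lambertW (A t S w) * (- beta)^-1)).
  by rewrite -mulr_suml /E /expect; field.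
by move=> w _; rewrite max_revenueE // mulrA.
Qed.

Let E_le t S : E t S <= h t S / exp_value t S.
Proof.
rewrite /E /h -mulrA ler_pM2l // -expectZ; apply: ler_expect => w.
by rewrite -AE lambertW_le // attraction_ge0.
Qed.

(** Here [A / (1 + A)] becomes [G / (X + G)]; a [D] common to all types lets the denominator leave
    the expectation. *)
Let E_ge t S D : (forall w, G t S w <= D) -> h t S / (exp_value t S + D) <= E t S.
Proof.
move=> GD; rewrite /E /h -mulrA ler_pM2l // -expectZ; apply: ler_expect => w.
have X0 := exp_value_gt0 t S; have G0 := G_ge0 t S w.
have A0 : 0 <= A t S w by exact: attraction_ge0.
apply: le_trans (lambertW_ge A0); rewrite AE.
have -> : G t S w / exp_value t S / (1 + G t S w / exp_value t S) =
  G t S w / (exp_value t S + G t S w).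
  by field; rewrite !gt_eqF // ltr_wpDr.
have D0 : 0 <= D := le_trans G0 (GD w).
by rewrite ler_wpM2l // lef_pV2 ?posrE ?lerD2l ?GD // ltr_wpDr.
Qed.

(** The constant [M] of the expansion [M t^n]: the logarithm of [M t^n] is
    [n (ln (mu t) - 1) + kappa(S)], the approximate value at demand [mu t] times [- beta]. *)
Definition exp_value_coef (S : {set O}) : R :=
  (mu * expR (-1)) ^+ #|S| * expR (kappa_set pX q S).

Let M := exp_value_coef.

Lemma exp_value_coef_gt0 S : 0 < exp_value_coef S.
Proof. by rewrite mulr_gt0 ?exprn_gt0 ?mulr_gt0 ?expR_gt0. Qed.

Lemma expR_kappa i : expR (kappa pX q i) = expect pX (fun w => expR (q i w)).
Proof. by rewrite lnK // posrE expect_gt0 // => w; exact: expR_gt0. Qed.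

Let coef i : R := mu * expR (-1) * expR (kappa pX q i).

Let coef_gt0 i : 0 < coef i.
Proof. by rewrite !mulr_gt0 // expR_gt0. Qed.

(** Thanks to this product rule, every option contributes the same leading term to [h], which yields
    the factor [|S|]. *)
Let M_setD1 (S : {set O}) i : i \in S -> coef i * M (S :\ i) = M S.
Proof.
move=> iS; rewrite /M /exp_value_coef (cardsD1 i S) iS exprS /kappa_set.
by rewrite (big_setD1 i iS) /= expRD /coef; ring.
Qed.

(** Exchanging the two sums produces the mean of [e^(q_i)], which is [e^(kappa_i)]. *)
Let hE t S : h t S = \sum_(i in S) coef i * exp_value t (S :\ i).
Proof.
rewrite /h /expect /G.
under eq_bigr do rewrite mulr_sumr.
rewrite exchange_big /= mulr_sumr; apply: eq_bigr => i _.
rewrite /coef expR_kappa /expect.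
rewrite mulr_sumr mulr_suml mulr_sumr; apply: eq_bigr => w _.
by rewrite expRD; ring.
Qed.

(** Applied to the sets [S :\ i], this provides the bound on [G] that [E_ge] requires. *)
Lemma near_exp_le S n (K : R) : 0 <= K ->
  (\forall t \near \oo, `|exp_value t S - M S * t%:R ^+ n| * t%:R
     <= K * (t%:R * ln t%:R) ^+ n) ->
  \forall t \near \oo, exp_value t S <= (M S + 1) * t%:R ^+ n.
Proof.
move=> K0 H; have c0 : 0 < (K + 1)^-1 by rewrite invr_gt0 ltr_wpDl.
near=> t.
have t1 : 1 <= t%:R :> R by near: t; exact: near_nat_ge.
have t0 : 0 < t%:R :> R by exact: lt_le_trans t1.
have lnt : ln t%:R ^+ n <= (K + 1)^-1 * t%:R.
  by near: t; exact: near_natr (near_ln_pow_le _ c0).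
have Ht : `|exp_value t S - M S * t%:R ^+ n| * t%:R <= K * (t%:R * ln t%:R) ^+ n.
  by near: t.
have u0 : 0 <= t%:R ^+ n :> R by rewrite exprn_ge0 // ltW.
have : `|exp_value t S - M S * t%:R ^+ n| <= t%:R ^+ n.
  rewrite -(ler_pM2r t0); apply: le_trans Ht _.
  have : (K + 1) * (t%:R ^+ n * ln t%:R ^+ n) <=
         (K + 1) * (t%:R ^+ n * ((K + 1)^-1 * t%:R)).
    by rewrite ler_wpM2l ?addr_ge0 // ler_wpM2l.
  have -> : (K + 1) * (t%:R ^+ n * ((K + 1)^-1 * t%:R)) = t%:R ^+ n * t%:R.
    by field; rewrite gt_eqF // ltr_wpDl.
  apply: le_trans; rewrite exprMn ler_wpM2r ?lerDl //.
  by rewrite mulr_ge0 // exprn_ge0 // ln_ge0.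
by rewrite ler_norml => /andP[_]; rewrite lerBlDr mulrDl mul1r addrC.
Unshelve. all: by end_near. Qed.

Lemma exp_value_asymptotics S : exists2 K : R, 0 <= K & \forall t \near \oo,
  `|exp_value t S - M S * t%:R ^+ #|S| | * t%:R <= K * (t%:R * ln t%:R) ^+ #|S|.
Proof.
move: {2}#|S| (erefl #|S|) => n; elim: n S => [|n IH] S Sn.
  (* With no options left the value is identically 0, so both the exponentiated value and its
     coefficient are 1. *)
  exists 0 => //; apply: nearW => t; rewrite Sn !expr0 /M /exp_value_coef Sn.
  move/eqP: Sn; rewrite cards_eq0 => /eqP ->.
  rewrite /kappa_set big_set0 expr0 expR0 !mulr1 /exp_value.
  suff -> : V t finset.set0 = 0 by rewrite mulr0 expR0 subrr normr0 mul0r.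
  elim: t => [|t IHt]; rewrite /V /= ?big_set0 // -/V IHt add0r.
  rewrite /expect big1 ?mulr0 // => w _.
  rewrite max_revenueE //; suff -> : attraction beta (fun i => q i w)
      (marginal (V t) (S := finset.set0)) = 0.
    by rewrite (@le_anti _ _ (lambertW 0) 0) ?lambertW_ge0 ?lambertW_le // mul0r mulr0.
  by rewrite /attraction big1 // => i _; have := valP i; rewrite finset.in_set0.
(* The guard [i \in S] lets the choice range over all options, with the dummy constant 0 outside
   [S]. *)
pose P i (k : R) := i \in S -> 0 <= k /\ \forall t \near \oo,
  `|exp_value t (S :\ i) - M (S :\ i) * t%:R ^+ n| * t%:R
    <= k * (t%:R * ln t%:R) ^+ n.
have [|K KP] := @choice _ _ P.
  move=> i; rewrite /P; have [iS|_] := boolP (i \in S); last by exists 0.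
  have Sin : #|S :\ i| = n by move: Sn; rewrite (cardsD1 i) iS => -[].
  by have [k k0] := IH _ Sin; rewrite Sin; exists k.
(* Summing over all types gives one bound on [G] for every type; the summand 1 ensures
   positivity. *)
pose D : R := 1 + \sum_w \sum_(i in S) expR (q i w - 1) * (M (S :\ i) + 1).
have D0 : 0 < D.
  rewrite ltr_wpDr // sumr_ge0 // => w _; rewrite sumr_ge0 // => i _.
  by rewrite mulr_ge0 ?expR_ge0 ?addr_ge0 // ltW // exp_value_coef_gt0.
rewrite Sn; apply: (@recursion_asymptotics _ n (fun t => exp_value t S)
  (fun t => E t S) (fun t => h t S) (M S) D (\sum_(i in S) coef i * K i)) => //.
- exact: exp_value_coef_gt0.
- by apply: sumr_ge0 => i /KP[k0 _]; rewrite mulr_ge0 // ltW.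
- have Xle : \forall t \near \oo, forall i, i \in S ->
      exp_value t (S :\ i) <= (M (S :\ i) + 1) * t%:R ^+ n.
    apply: filter_forall => i; have [iS|_] := boolP (i \in S); last by near=> t.
    have [k0 H] := KP i iS; have := near_exp_le k0 H.
    by apply: filterS => t Ht _.
  near=> t; apply: E_ge => w.
  have u0 : 0 <= t%:R ^+ n :> R by rewrite exprn_ge0.
  have Gw : G t S w <=
      (\sum_(i in S) expR (q i w - 1) * (M (S :\ i) + 1)) * t%:R ^+ n.
    rewrite mulr_suml; apply: ler_sum => i iS; rewrite -mulrA.
    rewrite ler_wpM2l ?expR_ge0 //.
    by move: i iS; near: t.
  apply: le_trans Gw _; rewrite ler_wpM2r // /D (bigD1 w) //= addrCA lerDl.
  rewrite addr_ge0 // sumr_ge0 // => w' _; rewrite sumr_ge0 // => i _.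
  by rewrite mulr_ge0 ?expR_ge0 ?addr_ge0 // ltW // exp_value_coef_gt0.
have XK : \forall t \near \oo, forall i, i \in S ->
    `|exp_value t (S :\ i) - M (S :\ i) * t%:R ^+ n| * t%:R
      <= K i * (t%:R * ln t%:R) ^+ n.
  apply: filter_forall => i; have [iS|_] := boolP (i \in S); last by near=> t.
  by have [_ H] := KP i iS; apply: filterS H => t Ht _.
near=> t; rewrite hE.
have -> : n.+1%:R * M S * t%:R ^+ n =
    \sum_(i in S) coef i * (M (S :\ i) * t%:R ^+ n).
  rewrite (eq_bigr (fun=> M S * t%:R ^+ n)); last first.
    by move=> i iS; rewrite mulrA M_setD1.
  by rewrite sumr_const Sn -mulrA mulr_natl.
rewrite -sumrB mulr_suml; apply: le_trans (ler_wpM2r _ (ler_norm_sum _ _ _)) _ => //.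
rewrite mulr_suml; apply: ler_sum => i iS.
rewrite -mulrBr normrM (gtr0_norm (coef_gt0 i)) -mulrA -[leRHS]mulrA.
apply: (ler_wpM2l (ltW (coef_gt0 i))).
by move: i iS; near: t.
Unshelve. all: by end_near. Qed.

End ValueAsymptotics.

(** * Linear bounds for the exponential and the logarithm near their base points *)

Section LogExpBounds.

Variable R : realType.

(** From [1 + y <= e^y] and [e^y (1 - y) <= 1]. *)
Lemma expR_sub1_le (y : R) : `|y| <= 1 / 2 -> `|expR y - 1| <= 2 * `|y|.
Proof.
rewrite ler_norml => /andP[y1 y2].
have := expR_ge1Dx y; have := expR_ge1Dx (- y); have := expR_gt0 y.
have := expRxMexpNx_1 y; set e := expR y; set f := expR (- y).
move=> ef e0 fy ey.
have ey1 : e * (1 - y) <= 1 by rewrite -[leRHS]ef ler_wpM2l // ltW.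
have [y0|y0] := leP 0 y.
  rewrite (ger0_norm y0) ger0_norm; last by lra.
  have e2 : e <= 2 by nra.
  have := ler_wpM2r y0 e2; lra.
rewrite (ltr0_norm y0) ler_norml; apply/andP; split; first by lra.
have : 0 <= e * - y by rewrite mulr_ge0 ?oppr_ge0 // ltW.
by lra.
Qed.

(** The logarithm lies between [d / (1 + d)] and [d], and [1 / (1 + d) <= 2]. *)
Lemma ln1D_le (d : R) : `|d| <= 1 / 2 -> `|ln (1 + d)| <= 2 * `|d|.
Proof.
rewrite ler_norml => /andP[d1 d2].
have p0 : 0 < 1 + d by lra.
have up : ln (1 + d) <= d by apply: le_ln1Dx; lra.
have dn : - ln (1 + d) <= (1 + d)^-1 - 1.
  rewrite -lnV ?posrE // -{1}(subrK 1 (1 + d)^-1) addrC; apply: le_ln1Dx.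
  by rewrite ltrBrDr addrC subrr invr_gt0.
have dE : (1 + d)^-1 - 1 = - d * (1 + d)^-1 by field; rewrite gt_eqF.
have i2 : (1 + d)^-1 <= 2 by rewrite -[leRHS]invrK lef_pV2 ?posrE //; lra.
have i0 : 0 < (1 + d)^-1 by rewrite invr_gt0.
have [d0|d0] := leP 0 d.
  by rewrite (ger0_norm d0) ler_norml; apply/andP; split; nra.
by rewrite (ltr0_norm d0) ler_norml; apply/andP; split; nra.
Qed.

End LogExpBounds.

(** * Asymptotics of values, prices and choice probabilities in the demand *)

Section Prices.

Local Open Scope classical_set_scope.
Local Open Scope ring_scope.

Variables (R : realType) (O Omega : finType) (pX : Omega -> R) (mu beta : R).
Variables (xi : O -> R) (q : O -> Omega -> R).
Hypotheses (pXP : is_pmf pX) (mu0 : 0 < mu) (beta_lt0 : beta < 0).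

Let f w := mnl beta (fun i => q i w).
Let V := value pX mu xi f.

(** The approximate value times [- beta], so that the estimates below are free of the price
    sensitivity. *)
Let v (S : {set O}) (x : R) : R := #|S|%:R * (ln x - 1) + kappa_set pX q S.

(** Writing the exponentiated value as [M t^n (1 + d)], the error in the logarithm is exactly
    [ln (1 + d)]. *)
Lemma value_asymptotics_periods S : exists2 K : R, 0 <= K & \forall t \near \oo,
  `|- beta * V t S - v S (mu * t%:R)| * t%:R <= K * ln t%:R ^+ #|S|.
Proof.
have [K K0 HK] := exp_value_asymptotics xi q pXP mu0 beta_lt0 S.
pose M := exp_value_coef pX mu q S.
have M0 : 0 < M by exact: exp_value_coef_gt0.
(* Chosen so that [ln^n t <= c t] forces [|d| <= 1/2], as [ln1D_le] demands. *)
pose c := M / (2 * (K + 1)).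
have K1 : 0 < K + 1 by rewrite ltr_wpDl.
have c0 : 0 < c by rewrite divr_gt0 // mulr_gt0.
exists (2 * K / M); first by rewrite !mulr_ge0 // invr_ge0 ltW.
near=> t.
have t1 : 1 <= t%:R :> R by near: t; exact: near_nat_ge.
have t0 : 0 < t%:R :> R by exact: lt_le_trans t1.
have lnt : ln t%:R ^+ #|S| <= c * t%:R.
  by near: t; exact: near_natr (near_ln_pow_le _ c0).
have XK : `|exp_value pX mu beta xi q t S - M * t%:R ^+ #|S| | * t%:R
    <= K * (t%:R * ln t%:R) ^+ #|S|.
  by near: t.
set n := #|S| in lnt XK *; set X := exp_value _ _ _ _ _ _ _ in XK.
have l0 : 0 <= ln t%:R ^+ n :> R by rewrite exprn_ge0 // ln_ge0.
have u0 : 0 < t%:R ^+ n :> R by rewrite exprn_gt0.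
have Mu0 : 0 < M * t%:R ^+ n by rewrite mulr_gt0.
pose d := X / (M * t%:R ^+ n) - 1.
have dE : X - M * t%:R ^+ n = M * t%:R ^+ n * d.
  by rewrite /d; field; rewrite !gt_eqF.
have {dE}dK : M * (`|d| * t%:R) <= K * ln t%:R ^+ n.
  move: XK; rewrite dE normrM (gtr0_norm Mu0) exprMn => H.
  by rewrite -(ler_pM2l u0); lra.
have d2 : `|d| <= 1 / 2.
  rewrite -(ler_pM2r t0) -(ler_pM2l M0); apply: le_trans dK _.
  have : (K + 1) * ln t%:R ^+ n <= (K + 1) * (c * t%:R) by rewrite ler_pM2l.
  rewrite (_ : (K + 1) * (c * t%:R) = M * (1 / 2 * t%:R)); last first.
    by rewrite /c; field; rewrite gt_eqF.
  by lra.
have lnXR (y : R) : 0 < y -> ln (y ^+ n) = n%:R * ln y.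
  by move=> y0; rewrite lnXn // mulr_natl.
have -> : - beta * V t S - v S (mu * t%:R) = ln (1 + d).
  have -> : 1 + d = X / (M * t%:R ^+ n) by rewrite /d addrC subrK.
  rewrite ln_div ?posrE ?expR_gt0 // /X expRK; congr (_ - _).
  rewrite lnM ?posrE // lnM ?posrE ?exprn_gt0 ?expR_gt0 ?mulr_gt0 ?expR_gt0 //.
  rewrite expRK !lnXR ?mulr_gt0 ?expR_gt0 // lnM ?posrE ?expR_gt0 // expRK.
  by rewrite /v -/n lnM ?posrE //; ring.
rewrite mulrAC ler_pdivlMr //.
have : `|ln (1 + d)| * t%:R * M <= 2 * `|d| * t%:R * M.
  by rewrite !ler_pM2r // ln1D_le.
by lra.
Unshelve. all: by end_near. Qed.

(** The window for [mu * t] has width [2 * mu] so as to contain both the period of demand [x] and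
    its predecessor; replacing [ln (mu t)] by [ln x] costs [O(1 / x)]. *)
Lemma value_asymptotics S : exists2 K : R, 0 <= K & \forall x \near +oo,
  forall t, x - 2 * mu <= mu * t%:R <= x ->
  `|- beta * V t S - v S x| * x <= K * ln x ^+ #|S|.
Proof.
have [K K0 [t0 _ HK]] := value_asymptotics_periods S.
(* The first term comes from [x <= 2 mu t] and [ln t <= 2 ln x], the second from the change of
   argument in [v]. *)
exists (K * 2 ^+ #|S| * (2 * mu) + #|S|%:R * (4 * mu)).
  by rewrite addr_ge0 ?mulr_ge0 ?exprn_ge0 // ltW.
near=> x => t /andP[tx1 tx2]; set n := #|S|.
have x1 : 1 <= x by near: x; exact: near_real_ge.
have x0 : 0 < x by exact: lt_le_trans x1.
have x4 : 4 * mu <= x by near: x; exact: near_real_ge.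
have xt0 : 2 * mu * t0.+1%:R <= x by near: x; exact: near_real_ge.
have xe : expR 1 <= x by near: x; exact: near_real_ge.
have xmu : mu^-1 <= x by near: x; exact: near_real_ge.
have lnx1 : 1 <= ln x.
  by rewrite -{1}(expRK 1) ler_ln ?posrE ?expR_gt0.
have mut : x / 2 <= mu * t%:R by lra.
have tt0 : (t0 < t)%N.
  rewrite -(ler_nat R) -(ler_pM2l mu0); apply: le_trans mut.
  by rewrite ler_pdivlMr //; lra.
have t0R : 0 < t%:R :> R by rewrite ltr0n (leq_ltn_trans _ tt0).
have t1R : 1 <= t%:R :> R by rewrite ler1n (leq_ltn_trans _ tt0).
have mut0 : 0 < mu * t%:R by rewrite mulr_gt0.
have lnt : ln t%:R <= 2 * ln x.
  have -> : 2 * ln x = ln (x * x) by rewrite lnM ?posrE //; ring.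
  rewrite ler_ln ?posrE ?mulr_gt0 //.
  have : t%:R <= mu^-1 * x by rewrite mulrC ler_pdivlMr // mulrC.
  by move/le_trans; apply; rewrite ler_pM2r.
have {HK} := HK t (ltnW tt0); rewrite -/n /= => HK.
have first : `|- beta * V t S - v S (mu * t%:R)| * x
    <= K * 2 ^+ n * (2 * mu) * ln x ^+ n.
  have : `|- beta * V t S - v S (mu * t%:R)| * x <=
     `|- beta * V t S - v S (mu * t%:R)| * t%:R * (2 * mu).
    by rewrite -mulrA ler_wpM2l //; lra.
  move/le_trans; apply; rewrite [leRHS]mulrAC ler_pM2r ?mulr_gt0 //.
  apply: le_trans HK _; rewrite -mulrA ler_wpM2l // -exprMn.
  by rewrite lerXn2r ?nnegrE ?ln_ge0 // mulr_ge0 // (le_trans ler01).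
have second : `|v S (mu * t%:R) - v S x| * x <= n%:R * (4 * mu) * ln x ^+ n.
  have -> : v S (mu * t%:R) - v S x = - (n%:R * (ln x - ln (mu * t%:R))).
    by rewrite /v -/n; ring.
  have l0 : 0 <= ln x - ln (mu * t%:R) by rewrite subr_ge0 ler_ln ?posrE.
  rewrite normrN ger0_norm ?mulr_ge0 // -!mulrA ler_wpM2l //.
  (* The difference of logarithms is at most [(x - mu t) / (mu t)], with numerator at most [2 mu]
     and denominator at least [x / 2]. *)
  have ub : (ln x - ln (mu * t%:R)) * x <= 4 * mu.
    have : ln x - ln (mu * t%:R) <= x / (mu * t%:R) - 1.
      rewrite -ln_div ?posrE // -{1}(subrK 1 (x / _)) addrC; apply: le_ln1Dx.
      by rewrite ltrBrDr addrC subrr divr_gt0.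
    rewrite (_ : _ / _ - 1 = (x - mu * t%:R) / (mu * t%:R)); last first.
      by field; rewrite !gt_eqF.
    rewrite ler_pdivlMr // => H.
    have : (ln x - ln (mu * t%:R)) * (x / 2) <=
           (ln x - ln (mu * t%:R)) * (mu * t%:R) by rewrite ler_wpM2l.
    by lra.
  apply: le_trans ub _; rewrite mulrA ler_peMr ?mulr_ge0 ?(ltW mu0) //.
  by rewrite exprn_ege1.
rewrite mulrDl; apply: le_trans (lerD first second).
rewrite -mulrDl ler_wpM2r ?(ltW x0) //.
by apply: le_trans (ler_normD _ _); rewrite addrA subrK.
Unshelve. all: by end_near. Qed.


(** Truncation loses at most one period and the predecessor at most another; at zero periods the
    predecessor is again 0. *)
Lemma periods_bounds (x : R) : 0 <= x ->
  x - 2 * mu <= mu * (periods mu x)%:R <= x /\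
  x - 2 * mu <= mu * (periods mu x).-1%:R <= x.
Proof.
move=> x0; have /andP[Tx xT] := truncn_itv (divr_ge0 x0 (ltW mu0)).
rewrite -/(periods mu x) in Tx xT.
have {}Tx : mu * (periods mu x)%:R <= x by rewrite mulrC -ler_pdivlMr.
have {}xT : x <= mu * (periods mu x)%:R + mu.
  by move: xT; rewrite ltr_pdivrMr // -natr1 => /ltW; lra.
have := mu0; case: (periods mu x) Tx xT => [|n] /= Tx xT mu_gt0.
  by split; apply/andP; split; lra.
by move: Tx xT; rewrite -(natr1 n) => Tx xT; split; apply/andP; split; lra.
Qed.

Let delta (S : {set O}) x : vec R S := marginal (V (periods mu x).-1) (S := S).

(** Subtracting the expansions for [S] and [S :\ i] at the same period leaves one [ln x - 1] and one
    [kappa]. *)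
Lemma marginal_asymptotics (S : {set O}) :
  exists2 K : R, 0 <= K & \forall x \near +oo,
  forall i : {i | i \in S},
  `|- beta * @delta S x i - (ln x - 1 + kappa pX q (val i))| * x
    <= K * ln x ^+ #|S|.
Proof.
have [K0 K00 HK0] := value_asymptotics S.
pose P i (k : R) := 0 <= k /\ \forall x \near +oo, forall t,
  x - 2 * mu <= mu * t%:R <= x ->
  `|- beta * V t (S :\ i) - v (S :\ i) x| * x <= k * ln x ^+ #|S :\ i|.
have [|K KP] := @choice _ _ P.
  by move=> i; have [k k0 H] := value_asymptotics (S :\ i); exists k.
have sumK_ge0 : 0 <= \sum_i K i by apply: sumr_ge0 => i _; have [] := KP i.
exists (K0 + \sum_i K i); first by rewrite addr_ge0.
have HK : \forall x \near +oo, forall i t, x - 2 * mu <= mu * t%:R <= x ->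
    `|- beta * V t (S :\ i) - v (S :\ i) x| * x <= K i * ln x ^+ #|S :\ i|.
  by apply: filter_forall => i; have [] := KP i.
near=> x => -[i iS] /=.
have ln1 : 1 <= ln x by near: x; exact: near_ln_ge1.
have x0 : 0 <= x by near: x; exact: near_real_ge.
have [_ Tx] := periods_bounds x0.
have H0 : `|- beta * V (periods mu x).-1 S - v S x| * x <= K0 * ln x ^+ #|S|.
  (* The period depends on [x], so it is generalized to any period in the window before the eventual
     bound is used. *)
  by move: Tx; move: (_.-1); near: x.
have Hi : `|- beta * V (periods mu x).-1 (S :\ i) - v (S :\ i) x| * x
    <= K i * ln x ^+ #|S :\ i|.
  by move: Tx; move: (_.-1); move: {iS}i; near: x.
have l0 : 0 <= ln x ^+ #|S :\ i| by rewrite exprn_ge0 // (le_trans ler01).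
have ll : ln x ^+ #|S :\ i| <= ln x ^+ #|S|.
  by rewrite (cardsD1 i S) iS exprS ler_peMl.
have -> : - beta * @delta S x (exist _ i iS) - (ln x - 1 + kappa pX q i) =
    (- beta * V (periods mu x).-1 S - v S x) -
    (- beta * V (periods mu x).-1 (S :\ i) - v (S :\ i) x).
  rewrite /delta /marginal /v /kappa_set (big_setD1 i iS) /=.
  have -> : #|S|%:R = 1 + #|S :\ i|%:R :> R by rewrite (cardsD1 i S) iS natrD.
  by ring.
apply: le_trans (ler_wpM2r x0 (ler_normB _ _)) _.
rewrite mulrDl [leRHS]mulrDl lerD //; apply: le_trans Hi _.
have Ki : K i <= \sum_j K j.
  by rewrite (bigD1 i) //= lerDl sumr_ge0 // => j _; have [] := KP j.
by apply: ler_pM => //; have [] := KP i.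
Unshelve. all: by end_near. Qed.

Let price x (S : {set O}) w : vec R S :=
  optimal_price pX mu xi f (periods mu x) w.

Let markup x (S : {set O}) w : R :=
  lambertW (attraction beta (fun i => q i w) (@delta S x)).

Let priceE x (S : {set O}) w (i : {i | i \in S}) :
  - beta * price x w i = - beta * @delta S x i + 1 + markup x S w.
Proof.
rewrite /price /optimal_price maximizerE // /markup_price -/(@delta S x).
by rewrite /markup; field; rewrite lt_eqF.
Qed.

Let choiceE x (S : {set O}) w (i : {i | i \in S}) :
  optimal_choice pX mu xi f (periods mu x) w i =
    expR (q (val i) w + beta * price x w i) / (1 + markup x S w).
Proof.
by rewrite /price /optimal_choice /optimal_price maximizerE // /f mnl_markup_price.
Qed.

(** As [W(A) <= A], it suffices that each term of [A] is [O(1 / x)]. The [+ 1] in the exponent of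
    the constant absorbs the error of the marginal value, eventually at most 1. *)
Lemma markup_asymptotics (S : {set O}) w :
  exists2 K : R, 0 <= K & \forall x \near +oo,
  0 <= markup x S w /\ markup x S w * x <= K.
Proof.
have [K K0 HK] := marginal_asymptotics S.
exists (\sum_(i : {i | i \in S}) expR (q (val i) w - kappa pX q (val i) + 1)).
  by apply: sumr_ge0 => i _; exact: expR_ge0.
have c0 : 0 < (K + 1)^-1 by rewrite invr_gt0 ltr_wpDl.
near=> x.
have x1 : 1 <= x by near: x; exact: near_real_ge.
have x0 : 0 < x by exact: lt_le_trans x1.
have lnx : ln x ^+ #|S| <= (K + 1)^-1 * x by near: x; exact: near_ln_pow_le.
have A0 : 0 <= attraction beta (fun i => q i w) (@delta S x) by exact: attraction_ge0.
split; first exact: lambertW_ge0.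
apply: le_trans (ler_wpM2r (ltW x0) (lambertW_le A0)) _.
rewrite /attraction mulr_suml; apply: ler_sum => i _.
have : `|- beta * @delta S x i - (ln x - 1 + kappa pX q (val i))| * x
    <= K * ln x ^+ #|S|.
  by move: i; near: x.
set y := _ - (_ - _ + _) => yK.
have y1 : `|y| <= 1.
  rewrite -(ler_pM2r x0) mul1r; apply: le_trans yK _.
  apply: le_trans (ler_wpM2l K0 lnx) _; rewrite mulrA ler_piMl ?(ltW x0) //.
  by rewrite ler_pdivrMr ?mul1r ?lerDl // ltr_wpDl.
rewrite -{2}(lnK (x0 : x \in Num.pos)) -expRD ler_expR.
by move: y1; rewrite ler_norml => /andP[]; rewrite /y; lra.
Unshelve. all: by end_near. Qed.

(** The 1 in the markup cancels the [- 1] of the marginal value, and the remaining [O(1 / x)] is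
    absorbed because [ln x >= 1]. The markup bounds are restated so that one [K] serves for the
    choice probabilities. *)
Lemma price_asymptotics (S : {set O}) w :
  exists2 K : R, 0 <= K & \forall x \near +oo,
  [/\ 0 <= markup x S w, markup x S w * x <= K & forall i : {i | i \in S},
  `|- beta * price x w i - (ln x + kappa pX q (val i))| * x <= K * ln x ^+ #|S|].
Proof.
have [K K0 HK] := marginal_asymptotics S.
have [K1 K10 HK1] := markup_asymptotics S w.
exists (K + K1); first exact: addr_ge0.
near=> x.
have ln1 : 1 <= ln x by near: x; exact: near_ln_ge1.
have x0 : 0 <= x by near: x; exact: near_real_ge.
have [r0 rK] : 0 <= markup x S w /\ markup x S w * x <= K1 by near: x.
split=> // [|i]; first by apply: le_trans rK _; rewrite lerDr.
have : `|- beta * @delta S x i - (ln x - 1 + kappa pX q (val i))| * x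
    <= K * ln x ^+ #|S|.
  by move: i; near: x.
move=> dK; rewrite priceE.
rewrite (_ : _ - (ln x + _) = - beta * @delta S x i -
  (ln x - 1 + kappa pX q (val i)) + markup x S w); last by ring.
apply: le_trans (ler_wpM2r x0 (ler_normD _ _)) _.
rewrite mulrDl [leRHS]mulrDl lerD // ger0_norm //; apply: le_trans rK _.
by rewrite ler_peMr // exprn_ege1.
Unshelve. all: by end_near. Qed.

(** With [y] the scaled price error and [r] the markup term, the probability is
    [c_i / x * e^(-y) / (1 + r)], where both [y] and [r] are [O(ln^n x / x)]. *)
Lemma choice_asymptotics (S : {set O}) w :
  exists2 K : R, 0 <= K & \forall x \near +oo,
  forall i : {i | i \in S},
  `|optimal_choice pX mu xi f (periods mu x) w i
     - 1 / x * expR (q (val i) w - kappa pX q (val i))| * x ^+ 2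
    <= K * ln x ^+ #|S|.
Proof.
have [K K0 HK] := price_asymptotics S w.
pose c i := expR (q i w - kappa pX q i).
have c_gt0 i : 0 < c i by exact: expR_gt0.
pose sum_c := \sum_(i : {i | i \in S}) c (val i).
have sum_c_ge0 : 0 <= sum_c by apply: sumr_ge0 => i _; exact: ltW.
(* [sum_c] dominates each [c_i]; of the three [K], two come from [2 |y|] and one from [r]. *)
exists (sum_c * (3 * K)); first by rewrite !mulr_ge0.
pose d := (2 * (K + 1))^-1.
have d0 : 0 < d by rewrite invr_gt0 mulr_gt0 // ltr_wpDl.
near=> x => i.
have ln1 : 1 <= ln x by near: x; exact: near_ln_ge1.
have x1 : 1 <= x by near: x; exact: near_real_ge.
have x0 : 0 < x by exact: lt_le_trans x1.
have lnx : ln x ^+ #|S| <= d * x by near: x; exact: near_ln_pow_le.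
have l1 : 1 <= ln x ^+ #|S| by rewrite exprn_ege1.
have [r0 rK /(_ i)] : [/\ 0 <= markup x S w, markup x S w * x <= K &
  forall i : {i | i \in S},
    `|- beta * price x w i - (ln x + kappa pX q (val i))| * x <= K * ln x ^+ #|S|].
  by near: x.
set r := markup x S w in r0 rK *.
set y := _ - (_ + _) => yK.
have y2 : `|- y| <= 1 / 2.
  rewrite normrN -(ler_pM2r x0); apply: le_trans yK _.
  apply: le_trans (ler_wpM2l K0 lnx) _; rewrite mulrA ler_wpM2r ?(ltW x0) //.
  by rewrite /d ler_pdivrMr ?mulr_gt0 ?ltr_wpDl //; lra.
have r1 : 0 < 1 + r by rewrite ltr_wpDr.
rewrite choiceE -/r.
have -> : expR (q (val i) w + beta * price x w i) = c (val i) / x * expR (- y).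
  rewrite -{2}(lnK (x0 : x \in Num.pos)) -expRB -expRD; congr expR.
  by rewrite /y; ring.
rewrite -/(c (val i)).
have -> : c (val i) / x * expR (- y) / (1 + r) - 1 / x * c (val i) =
    c (val i) / x * ((expR (- y) - 1 - r) / (1 + r)).
  by field; rewrite !gt_eqF.
rewrite normrM ger0_norm ?divr_ge0 ?(ltW x0) ?(ltW (c_gt0 _)) //.
have bound : `|(expR (- y) - 1 - r) / (1 + r)| * x <= 3 * K * ln x ^+ #|S|.
  apply: le_trans (_ : (2 * `|y| + r) * x <= _); last first.
    have : K <= K * ln x ^+ #|S| by rewrite ler_peMr.
    by lra.
  rewrite ler_wpM2r ?(ltW x0) // normrM normfV (gtr0_norm r1) ler_pdivrMr //.
  have e1 : `|expR (- y) - 1 - r| <= 2 * `|y| + r.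
    apply: le_trans (ler_normB _ _) _; rewrite (ger0_norm r0) lerD2r.
    by rewrite -[`|y|]normrN expR_sub1_le.
  by apply: le_trans e1 _; rewrite ler_peMr ?addr_ge0 ?mulr_ge0 // lerDl.
rewrite (_ : _ * x ^+ 2 =
  c (val i) * (`|(expR (- y) - 1 - r) / (1 + r)| * x)); last first.
  by field; rewrite gt_eqF.
apply: le_trans (ler_wpM2l (ltW (c_gt0 _)) bound) _.
rewrite -[leRHS]mulrA; apply: ler_wpM2r.
  by rewrite !mulr_ge0 // (le_trans ler01).
by rewrite /sum_c (bigD1 i) //= lerDl sumr_ge0 // => j _; exact: ltW.
Unshelve. all: by end_near. Qed.

End Prices.

(** * Passage to Landau notation *)

Lemma bigO_ln_pow (R : realType) (g : R -> R) (K : R) (n j : nat) :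
  (\forall x \near +oo, `|g x| * x ^+ j <= K * ln x ^+ n) ->
  \forall k \near +oo, \forall x \near pinfty_filter_on R,
    `|g x| <= k * `|ln x ^+ n / x ^+ j|.
Proof.
(* The Landau form asks for all large [k]; any [k >= K] works, since the comparison function is
   nonnegative for [x >= 1]. *)
move=> gK; near=> k; near=> x.
have x1 : 1 <= x by near: x; exact: near_real_ge.
have xj0 : 0 < x ^+ j by rewrite exprn_gt0 // (lt_le_trans ltr01).
have l0 : 0 <= ln x ^+ n by rewrite exprn_ge0 // ln_ge0.
rewrite [`|_ / _|]ger0_norm ?divr_ge0 ?(ltW xj0) // mulrA ler_pdivlMr //.
have Kk : K <= k by near: k; exact: near_real_ge.
apply: le_trans (ler_wpM2r l0 Kk).
by near: x.
Unshelve. all: by end_near. Qed.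

Theorem theorem1 (R : realType) (L Kb Ks : nat) (xi : 'I_L -> R)
    (Omega : finType) (pX : Omega -> R) (mu beta_p : R)
    (q : item_option L Kb -> Omega -> R) (S : {set item_option L Kb})
    (hpX : is_pmf pX) (hmu0 : 0 < mu) (hmu1 : mu <= 1) (hbeta : beta_p < 0)
    (hS : S \in feasible_sets L Kb Ks) :
  let rho := fun w : Omega => mnl beta_p (fun i => q i w) in
  let xiO := option_salvage xi in
  let T := periods mu in
  let n := #|S| in
  ((fun lambda : R =>
      value pX mu xiO rho (T lambda) S - approx_value pX beta_p q S lambda)
    =O_ (pinfty_nbhs R) (fun lambda => ln lambda ^+ n / lambda)) /\
  (forall (i : {i | i \in S}) (w : Omega),
    ((fun lambda : R => optimal_price pX mu xiO rho (T lambda) w i)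
      = (fun lambda => - 1 / beta_p * (ln lambda + kappa pX q (val i)))
        +O_ (pinfty_nbhs R) (fun lambda => ln lambda ^+ n / lambda)) /\
    ((fun lambda : R => optimal_choice pX mu xiO rho (T lambda) w i)
      = (fun lambda => 1 / lambda * expR (q (val i) w - kappa pX q (val i)))
        +O_ (pinfty_nbhs R) (fun lambda => ln lambda ^+ n / lambda ^+ 2))).
Proof.
move=> rho xiO T n.
have b0 : beta_p != 0 by rewrite lt_eqF.
have nb0 : 0 < - beta_p by rewrite oppr_gt0.
(* The bounds on values and prices were proved after scaling by [- beta_p]; undoing this multiplies
   their constants by [(- beta_p)^-1]. *)
have scale_norm (y : R) : `|- 1 / beta_p * y| = (- beta_p)^-1 * `|y|.
  by rewrite normrM mulN1r -invrN gtr0_norm ?invr_gt0.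
split=> [|i w].
  apply/eqOP.
  have [K K0 HK] := value_asymptotics xiO q hpX hmu0 hbeta S.
  apply: (@bigO_ln_pow _ _ ((- beta_p)^-1 * K) n 1).
  near=> x; have x0 : 0 <= x by near: x; exact: near_real_ge.
  have [Tx _] := periods_bounds hmu0 x0.
  rewrite (_ : value _ _ _ _ _ _ - _ = - 1 / beta_p *
    (- beta_p * value pX mu xiO rho (T x) S
      - (n%:R * (ln x - 1) + kappa_set pX q S))).
    rewrite scale_norm -!mulrA ler_pM2l ?invr_gt0 // expr1.
    by move: Tx; rewrite -/(T x); move: (T x); near: x.
  by rewrite /approx_value -/n; field.
split.
  apply/eqaddOP.
  have [K K0 HK] := price_asymptotics xiO q hpX hmu0 hbeta S w.
  apply: (@bigO_ln_pow _ _ ((- beta_p)^-1 * K) n 1).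
  near=> x.
  rewrite (_ : (_ - _) x = - 1 / beta_p *
    (- beta_p * optimal_price pX mu xiO rho (T x) w i
      - (ln x + kappa pX q (val i)))).
    rewrite scale_norm -!mulrA ler_pM2l ?invr_gt0 // expr1.
    by move: i; near: x; apply: filterS HK => x [].
  by rewrite !fctE /T; field.
apply/eqaddOP.
have [K K0 HK] := choice_asymptotics xiO q hpX hmu0 hbeta S w.
apply: (@bigO_ln_pow _ _ K n 2).
by apply: filterS HK => x /(_ i).
Unshelve. all: by end_near. Qed.
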